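(* Let $N\ge3$. For $2\le k\le N-1$ let $$\alpha_k(x)=e_{kk}+\sum_{j=1}^{N-1}a_{kj}x^j\in M_N(\mathbb{C}[x]),\qquad a_{kj}=(-1)^{j+1}\big(\delta_{k,j+1}e_{k1}+\delta_{k,N-j}e_{Nk}\big)+(-1)^j\delta_{N,j+1}e_{N1}\quad(1\le j\le N-1),$$ and let $\alpha_1=I-\sum_{k=2}^{N-1}\alpha_k$. Then $\{\alpha_k\}_{1\le k\le N-1}$ is a Pierce decomposition of the algebra $\mathbb{A}$.
   Context: $e_{rs}$ is the $N\times N$ matrix with $1$ at entry $(r,s)$ and zeros elsewhere; $\delta$ is the Kronecker delta; $S_N=\sum_{s=1}^{N-1}e_{s,s+1}$. Let $\psi(x,z)=e^{xz}\big(Iz+\sum_{m=1}^{N}(-1)^mS_N^{m-1}x^{-m}\big)$, for $x\in\mathbb{C}\setminus\{0\}$, $z\in\mathbb{C}$. A differential operator $\mathcal{B}=\mathcal{B}(z,\partial_z)=\sum_{j=0}^{m}\partial_z^j\cdot b_j(z)$ (with $b_j$ $N\times N$ matrix valued meromorphic functions on a suitable nonempty connected open subset of $\mathbb{C}$) acts on $\psi$ from the right by $\psi\mathcal{B}=\sum_{j=0}^{m}(\partial_z^j\psi)\,b_j(z)$, and $$\mathbb{A}=\{\theta\in M_N(\mathbb{C}[x])\mid \exists\,\mathcal{B}=\mathcal{B}(z,\partial_z):\ (\psi\mathcal{B})(x,z)=\theta(x)\psi(x,z)\}.$$ A Pierce decomposition of a noncommutative ring $R$ with unit $1$ is a finite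 set of elements $r_1,\dots,r_n\in R$ such that $1=\sum_{j=1}^{n}r_j$ and $r_ir_j=\delta_{ij}r_i$ for all $1\le i,j\le n$. *)

(* Defs.v *)
(* Mathematical Components + MathComp-Analysis.  The complex numbers are R[i]
   for an arbitrary R : realType (unique up to isomorphism). *)
From HB Require Import structures.
From mathcomp Require Import all_boot all_order all_algebra.
From mathcomp Require Import complex.
From mathcomp Require Import all_classical all_reals all_analysis.

Set Implicit Arguments.
Unset Strict Implicit.
Unset Printing Implicit Defensive.

Import Order.TTheory GRing.Theory Num.Theory numFieldNormedType.Exports.
Local Open Scope classical_set_scope.
Local Open Scope ring_scope.

(* The topology and norm of a numFieldType are inferred from a packed structure,
   so R[i] is used through this one. *)
Definition Cplx (R : realType) : numFieldType := complex (Real.sort R).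

(* A is meant to be (the carrier of) a unital subring of T, so that the sum, the
   product and the unit of A are those of T. *)
Definition pierce_decomposition (T : pzRingType) (A : set T) (n : nat)
    (r : 'I_n -> T) : Prop :=
  [/\ forall i, A (r i),
      1 = \sum_(i < n) r i
    & forall i j, r i * r j = (i == j)%:R * r i].

Section ComplexFunctions.
Variable R : realType.
Local Notation C := (Cplx R).

Definition cexp (z : C) : C :=
  Complex (expR (complex.Re z) * cos (complex.Im z))
          (expR (complex.Re z) * sin (complex.Im z)).

Definition holomorphic_near (g : C -> C) (z0 : C) : Prop :=
  \forall z \near z0, derivable g z 1.

(* Meromorphic functions are represented by total functions; the values at the
   (isolated) singularities are irrelevant. *)
Definition meromorphic_at (f : C -> C) (z0 : C) : Prop :=
  exists (n : nat) (g : C -> C),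
    holomorphic_near g z0 /\ \forall z \near z0^', (z - z0) ^+ n * f z = g z.

Definition meromorphic_on (U : set C) (f : C -> C) : Prop :=
  forall z0, U z0 -> meromorphic_at f z0.

Definition mx_meromorphic_on (p q : nat) (U : set C) (b : C -> 'M[C]_(p, q))
    : Prop :=
  forall i j, meromorphic_on U (fun z => b z i j).

Definition mx_derive1n (p q : nat) (j : nat) (F : C -> 'M[C]_(p, q)) (z : C)
    : 'M[C]_(p, q) :=
  \matrix_(i, l) derive1n j (fun w : C => F w i l) z.

End ComplexFunctions.

Section AlgebraA.
Variables (R : realType) (N : nat).
Local Notation C := (Cplx R).

(* The matrix unit e_{rs}, with r and s counted from 1. *)
Definition emx (r s : nat) : 'M[C]_N :=
  \matrix_(i, j) ((i.+1 == r) && (j.+1 == s))%:R.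

Definition shift_mx : 'M[C]_N := \sum_(1 <= s < N) emx s s.+1.

Definition psi (x z : C) : 'M[C]_N :=
  cexp (x * z) *:
    (z%:M + \sum_(1 <= m < N.+1) ((-1) ^+ m * x ^- m) *: shift_mx ^+ m.-1).

(* The right action on F = F(z) of the differential operator
   \sum_(j <= m) \partial_z^j b_j(z). *)
Definition right_action (m : nat) (b : 'I_m.+1 -> C -> 'M[C]_N)
    (F : C -> 'M[C]_N) (z : C) : 'M[C]_N :=
  \sum_(j < m.+1) mx_derive1n j F z *m b j z.

Definition mx_eval (theta : 'M[{poly C}]_N) (x : C) : 'M[C]_N :=
  map_mx (fun p => p.[x]) theta.

(* For each x != 0, (psi B)(x, z) = theta(x) psi(x, z) is an identity between
   functions of z meromorphic on U; hence the punctured neighborhoods, which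
   disregard the poles of the coefficients of B. *)
Definition algA : set 'M[{poly C}]_N :=
  [set theta | exists (U : set C) (m : nat) (b : 'I_m.+1 -> C -> 'M[C]_N),
    [/\ [/\ U !=set0, open U & connected U],
        forall j, mx_meromorphic_on U (b j)
      & forall x : C, x != 0 -> forall z0, U z0 ->
          \forall z \near z0^',
            right_action b (psi x) z = mx_eval theta x *m psi x z]].

Definition acoef (k j : nat) : 'M[C]_N :=
  (-1) ^+ j.+1 *: ((k == j.+1)%:R *: emx k 1 + (k == N - j)%N%:R *: emx N k)
  + (-1) ^+ j *: ((N == j.+1)%:R *: emx N 1).

Definition alpha_ge2 (k : nat) : 'M[{poly C}]_N :=
  map_mx polyC (emx k k) + \sum_(1 <= j < N) 'X^j *: map_mx polyC (acoef k j).

(* alpha_k for 1 <= k <= N - 1. *)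
Definition alpha (k : nat) : 'M[{poly C}]_N :=
  if k == 1%N then 1%:M - \sum_(2 <= l < N) alpha_ge2 l else alpha_ge2 k.

End AlgebraA.

(* Main.v *)
Require Import Defs.
From HB Require Import structures.
From mathcomp Require Import all_boot all_order all_algebra.
From mathcomp Require Import complex.
From mathcomp Require Import all_classical all_reals all_analysis.
From mathcomp Require Import ring lra zify.
Import Order.TTheory GRing.Theory Num.Theory numFieldNormedType.Exports.
Local Open Scope classical_set_scope.
Local Open Scope ring_scope.

(** Write [S] for the nilpotent shift and [Y = 'X + S], a polynomial matrix in
    [x].  The sum in [psi] is a truncated Neumann series which, because
    [S ^+ N = 0], equals [- (x + S)^-1]; so [psi = e^{xz} P] with
    [P (x + S) = (x + S) P = z (x + S) - 1] ([mul_psi_amp_pencil]).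

    Membership in the algebra.  Since [\partial_z^j psi = e^{xz} (x^j P + j x^(j-1))],
    the operator with coefficients [b_j(z)] acts on [psi] through its symbol
    [b = \sum_j b_j x^j], a polynomial in [x], by
    [psi B = e^{xz} (P b(x) + b'(x))] ([symbol_expansion]).  For a symbol of the
    form [b = Y h] the pole at [x = 0] cancels:
    [P Y h + (Y h)' = (z Y - 1) h + h + Y h' = Y (z h + h')].
    The map [h |-> z h + h'] is invertible on polynomials for [z != 0], with
    inverse a terminating Neumann series in [z^-1 d/dx] ([neumannK]).  Hence
    any [Y G] is reached, and with [G = M (z Y - 1)] one gets
    [Y G = Y M Y P]: every matrix [Y M Y] belongs to the algebra
    ([has_symbol_sandwich]).  The coefficients of the operator have their only
    pole at [z = 0], so the whole plane serves as domain for all these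
    operators at once, and they can be added.

    The elements [alpha_k].  For [2 <= k <= N - 1], [alpha_k] has rank one: it
    is a column [u_k], supported on the rows [k] and [N], times a row [v_k],
    supported on the columns [1] and [k] ([alpha_ge2E]).  The column is
    divisible by [Y] on the left and the row by [Y] on the right
    ([alpha_col_div], [alpha_row_div]), so [alpha_k = Y M Y] is in the algebra,
    and so is [alpha_1], as [1] has the constant symbol [1].  Finally
    [v_k u_l] is the Kronecker delta ([alpha_row_col]), which makes the
    [alpha_k] with [k >= 2] orthogonal idempotents; [alpha_1] is their
    complement ([pierce_complement]). *)

Set Implicit Arguments.
Unset Strict Implicit.
Unset Printing Implicit Defensive.

(** * The complex exponential *)

(** Differentiability in the division-free form [f (h + a) = f a + h df + o(h)],
    in which estimates can be multiplied and composed. *)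
Lemma is_derive_near (K : numFieldType) (f : K -> K) (a df : K) :
  is_derive a 1 f df <->
  forall eps, 0 < eps ->
    \forall h \near 0, `|f (h + a) - f a - h * df| <= eps * `|h|.
Proof.
have key l h eps : h != 0 ->
    (`|l - h^-1 *: (f (h *: 1 + a) - f a)| <= eps) =
    (`|f (h + a) - f a - h * l| <= eps * `|h|).
  move=> h0; rewrite -ler_pdivrMr ?normr_gt0 // -normfV -normrM.
  rewrite [h *: 1]mulr1 distrC; congr (`|_| <= _).
  by rewrite /GRing.scale /= mulrBl mulrAC divff // mul1r mulrC.
split=> [[fa <-] eps eps0|H].
  have := fa => /cvgrPdist_le /(_ eps eps0).
  rewrite near_withinE => Hh.
  near=> h; have [->|h0] := eqVneq h 0.
    by rewrite add0r mul0r subrr subr0 normr0 mulr0.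
  rewrite -key //; move: h0; near: h; exact: Hh.
have Hc : h^-1 *: ((f \o shift a) (h *: 1) - f a) @[h --> 0^'] --> df.
  apply/cvgrPdist_le => eps eps0.
  rewrite near_withinE; near=> h => h0; rewrite key //.
  by near: h; exact: H.
by split; [exact: cvgP Hc | exact: cvg_lim Hc].
Unshelve. all: by end_near. Qed.

Section ComplexExponential.
Variable R : realType.
Local Notation C := (Cplx R).
Local Notation Re := complex.Re.
Local Notation Im := complex.Im.

Lemma cexpD (z w : C) : cexp (z + w) = cexp z * cexp w.
Proof.
case: z w => [a b] [c d]; rewrite /cexp /= expRD cosD sinD.
apply/eqP; rewrite eq_complex /=; apply/andP; split; apply/eqP; ring.
Qed.

Lemma normc_le_ReIm (z : C) : `|z| <= (`|Re z| + `|Im z|)%:C%C.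
Proof.
rewrite {1}[z]complexE (le_trans (ler_normD _ _)) // normrM.
have -> : `|'i%C : C| = 1 by rewrite normc_def /= expr0n expr1n add0r sqrtr1.
rewrite mul1r.
by rewrite !normc_def /= expr0n /= !addr0 !sqrtr_sqr -rmorphD.
Qed.

Lemma normc_ge_Im (z : C) : `|Im z|%:C%C <= `|z|.
Proof.
rewrite normc_def lecR -sqrtr_sqr ler_wsqrtr // lerDr sqr_ge0 //.
Qed.

Lemma nbhs0_complex (P Q : R -> Prop) :
  (\forall a \near 0, P a) -> (\forall b \near 0, Q b) ->
  \forall h \near (0 : C), P (Re h) /\ Q (Im h).
Proof.
move=> /nbhs_ballP[d /= d0 HP] /nbhs_ballP[e /= e0 HQ].
have m0 : 0 < (Num.min d e)%:C%C :> C by rewrite ltcR lt_min d0.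
have := @nbhs0_lt C C _ m0; apply: filterS => h hm; split.
  apply: HP; rewrite /ball /= sub0r normrN.
  have := le_lt_trans (normc_ge_Re h) hm; rewrite ltcR lt_min.
  by case/andP.
apply: HQ; rewrite /ball /= sub0r normrN.
have := le_lt_trans (normc_ge_Im h) hm; rewrite ltcR lt_min.
by case/andP.
Qed.

(** The functional equation reduces the claim to the point [0], where
    [e^{a + ib} - 1 - (a + ib)] has real part
    [(e^a - 1 - a) + e^a (cos b - 1)] and imaginary part
    [e^a (sin b - b) + (e^a - 1) b]; each term is [o(|a| + |b|)] by one of the
    real derivatives at [0]. *)
Lemma is_derive_cexp (z : C) : is_derive z 1 (@cexp R) (cexp z).
Proof.
have D0 : is_derive (0 : C) 1 (@cexp R) 1.
  apply/is_derive_near => eps eps0.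
  (* the four terms below add up to at most [1 + 2 + 2 + 1] times [e `|h|] *)
  pose e := Re eps / 6; have epsE : eps = (6 * e)%:C%C.
    rewrite mulrC divfK // RRe_real //; exact: gtr0_real.
  have e0 : 0 < e by move: eps0; rewrite epsE ltcR pmulr_rgt0.
  have exp_near := (is_derive_near (@expR R) 0 _).1 (is_derive_expR 0) e e0.
  have cos_near := (is_derive_near (@cos R) 0 _).1 (is_derive_cos 0) e e0.
  have sin_near := (is_derive_near (@sin R) 0 _).1 (is_derive_sin 0) e e0.
  have exp_small : \forall a \near (0 : R), `|expR a - 1| <= Num.min 1 e.
    have : expR a @[a --> 0] --> expR (0 : R) by exact: continuous_expR.
    move=> /cvgrPdist_le /(_ (Num.min 1 e)); rewrite lt_min ltr01 => /(_ e0).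
    by apply: filterS => a; rewrite expR0 distrC.
  have exp2 : \forall a \near (0 : R),
      `|expR a - 1 - a| <= e * `|a| /\ `|expR a - 1| <= Num.min 1 e.
    near=> a; split; last by near: a.
    suff: `|expR (a + 0) - expR 0 - a * expR 0| <= e * `|a|.
      by rewrite addr0 expR0 mulr1.
    by near: a.
  have trig2 : \forall b \near (0 : R),
      `|cos b - 1| <= e * `|b| /\ `|sin b - b| <= e * `|b|.
    near=> b; split.
      suff: `|cos (b + 0) - cos 0 - b * - sin 0| <= e * `|b|.
        by rewrite addr0 cos0 sin0 oppr0 mulr0 subr0.
      by near: b.
    suff: `|sin (b + 0) - sin 0 - b * cos 0| <= e * `|b|.
      by rewrite addr0 cos0 sin0 mulr1 subr0.
    by near: b.
  apply: filterS (nbhs0_complex exp2 trig2) => -[a b] /= [] [].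
  rewrite addr0; move=> ea; rewrite le_min => /andP[ea1 eae] [cb sb].
  have ha := normc_ge_Re (Complex a b : C).
  have hb := normc_ge_Im (Complex a b : C).
  have hn : `|Complex a b : C| = (Re `|Complex a b : C|)%:C%C.
    by rewrite RRe_real // normr_real.
  set n := Re _ in hn; rewrite !hn !lecR /= in ha hb *.
  apply: le_trans (normc_le_ReIm _) _; rewrite epsE -rmorphM lecR /=.
  rewrite expR0 cos0 sin0 !(mulr0, mulr1, subr0, add0r).
  have -> : expR a * cos b - 1 - a = (expR a - 1 - a) + expR a * (cos b - 1).
    by ring.
  have -> : expR a * sin b - b = expR a * (sin b - b) + (expR a - 1) * b.
    by ring.
  have e2 : expR a <= 2 by move: ea1; rewrite ler_norml => /andP[]; lra.
  have n0 : 0 <= n by rewrite (le_trans _ ha).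
  have Ha : e * `|a| <= e * n by rewrite ler_pM2l.
  have Hb : e * `|b| <= e * n by rewrite ler_pM2l.
  have H1 : `|expR a * (cos b - 1)| <= 2 * (e * n).
    by rewrite normrM ler_pM // ?(le_trans cb) // ger0_norm ?expR_ge0.
  have H2 : `|expR a * (sin b - b)| <= 2 * (e * n).
    by rewrite normrM ler_pM // ?(le_trans sb) // ger0_norm ?expR_ge0.
  have H3 : `|(expR a - 1) * b| <= e * n by rewrite normrM ler_pM.
  have := ler_normD (expR a - 1 - a) (expR a * (cos b - 1)).
  have := ler_normD (expR a * (sin b - b)) ((expR a - 1) * b).
  by rewrite -mulrA; lra.
apply/is_derive_near => eps eps0.
have [cz0|cz0] := eqVneq (cexp z) 0.
  near=> h; rewrite cexpD cz0 !mulr0 !subrr normr0 mulr_ge0 //; exact: ltW.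
have c0 : 0 < `|cexp z| by rewrite normr_gt0.
have := (is_derive_near _ _ _).1 D0 _ (divr_gt0 eps0 c0).
apply: filterS => h; rewrite addr0 cexpD.
have -> : cexp (0 : C) = 1 by rewrite /cexp /= expR0 cos0 sin0 mulr1 mulr0.
rewrite mulr1 => H.
have -> : cexp h * cexp z - cexp z - h * cexp z = (cexp h - 1 - h) * cexp z.
  by ring.
by rewrite normrM -ler_pdivlMr // mulrAC.
Unshelve. all: by end_near. Qed.
End ComplexExponential.

Lemma is_derive_comp_mull (K : numFieldType) (f : K -> K) (a z l : K) :
  is_derive (a * z) 1 f l -> is_derive z 1 (fun w => f (a * w)) (a * l).
Proof.
move=> /is_derive_near fE; apply/is_derive_near => eps eps0.
have a1 : 0 < `|a| + 1 by rewrite ltr_wpDl.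
have /nbhs_ballP[d /= d0 near_f] := fE _ (divr_gt0 eps0 a1).
have da : 0 < d / (`|a| + 1) by rewrite divr_gt0.
apply: filterS (@nbhs0_lt K K _ da) => h hd.
have Hle : `|a * h| <= (`|a| + 1) * `|h| by rewrite normrM ler_wpM2r // lerDl.
rewrite mulrDr mulrCA mulrA; apply: le_trans (near_f (a * h) _) _.
  rewrite /ball /= sub0r normrN; apply: le_lt_trans Hle _.
  by rewrite mulrC -ltr_pdivlMr.
by rewrite -mulrA ler_pM2l // ler_pdivrMl.
Qed.

(** Of the complex exponential, only the equation [E' = E] matters here. *)
Section ExponentialDerivatives.
Variables (K : numFieldType) (E : K -> K).
Hypothesis E_deriv : forall w : K, is_derive w 1 E (E w).

Lemma is_derive_exp_affine (x d p z : K) :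
  is_derive z 1 (fun w : K => E (x * w) * (w * d + p))
    (E (x * z) * (z * (x * d) + (x * p + d))).
Proof.
have dE : is_derive z 1 (fun w : K => E (x * w)) (x * E (x * z)).
  exact: is_derive_comp_mull.
have dg : is_derive z 1 (fun w : K => d * w + p) d.
  apply/is_derive_near => eps eps0; near=> h.
  have -> : d * (h + z) + p - (d * z + p) - h * d = 0 by ring.
  by rewrite normr0 mulr_ge0 // ltW.
have -> : (fun w : K => E (x * w) * (w * d + p)) =
    (fun w : K => E (x * w)) * (fun w : K => d * w + p).
  by apply/funext => w; rewrite fctE [w * d]mulrC.
apply: is_derive_eq; rewrite /GRing.scale /=; ring.
Unshelve. all: by end_near. Qed.

(** On exponential times affine functions the derivation is
    [x + d/dz] on the affine factor, and [(x + d/dz)^j] stops after two terms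
    of its binomial expansion. *)
Lemma derive1n_exp_affine (x d p z : K) j :
  derive1n j (fun w : K => E (x * w) * (w * d + p)) z =
  E (x * z) * (x ^+ j * (z * d + p) + (x ^+ j.-1 *+ j) * d).
Proof.
suff -> : derive1n j (fun w : K => E (x * w) * (w * d + p)) =
    (fun z => E (x * z) * (z * (x ^+ j * d) + (x ^+ j * p + x ^+ j.-1 *+ j * d))).
  by congr (_ * _); ring.
elim: j => [|j IHj].
  apply/funext => w; rewrite derive1n0 expr0 !mul1r mulr0n mul0r addr0.
  by [].
rewrite derive1nS IHj; apply/funext => w; rewrite derive1E.
have [_ ->] := is_derive_exp_affine x (x ^+ j * d)
  (x ^+ j * p + x ^+ j.-1 *+ j * d) w.
congr (_ * _); rewrite exprS -!mulrA; congr (_ + _).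
rewrite mulrDr -addrA; congr (_ + _); case: j {IHj} => [|j] /=.
  by rewrite !mulr0n mul0r mulr0 add0r.
by rewrite mulrA mulrnAr -exprS -mulrDl -mulrSr.
Qed.

End ExponentialDerivatives.

(** * The plane is connected *)

Section Connected.
Variable R : realType.
Local Notation C := (Cplx R).
Local Notation Re := complex.Re.

(** The plane is the union of the segments from [0] to its points. *)
Lemma connected_Cplx : connected [set: C].
Proof.
pose ray (w : C) := [set t%:C%C * w | t in `[0, 1]%classic].
have -> : [set: C] = \bigcup_(w in [set: C]) ray w.
  apply/seteqP; split=> // w _; exists w => //; exists 1; last by rewrite mul1r.
  by rewrite /= in_itv /= lexx ler01.
apply: bigcup_connected.
  exists 0 => w _; exists 0; last by rewrite mul0r.
  by rewrite /= in_itv /= lexx ler01.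
move=> w _; apply: connected_continuous_connected.
  exact: segment_connected.
apply: continuous_subspaceT => t.
apply/cvgrPdist_le => eps eps0; rewrite near_simpl /=.
have [e e0 epsE] : exists2 e : R, 0 < e & eps = e%:C%C.
  exists (Re eps); last by rewrite RRe_real //; exact: gtr0_real.
  by move: eps0; rewrite ltcE => /andP[].
pose n := Re `|w|; have wE : `|w| = n%:C%C by rewrite RRe_real // normr_real.
have n0 : 0 <= n by have := normr_ge0 w; rewrite wE ler0c.
have d0 : 0 < e / (n + 1) by rewrite divr_gt0 // ltr_wpDl.
have : \forall s \near t, `|t - s| < e / (n + 1) by exact: (nbhsx_ballx t _ d0).
apply: filterS => s ts.
have n1 : 0 < n + 1 by rewrite ltr_wpDl.
rewrite -mulrBl normrM wE -rmorphB normc_def /= expr0n /= addr0 sqrtr_sqr.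
rewrite epsE -rmorphM lecR; apply: (@le_trans _ _ (`|t - s| * (n + 1))).
  by rewrite ler_wpM2l // lerDl.
by rewrite -ler_pdivlMr // ltW.
Qed.

End Connected.

(** * Closure properties of meromorphic functions *)

Section Meromorphic.
Variable K : numFieldType.

(** [meromorphic_at], over an abstract field; the two are convertible at the
    complex numbers. *)
Definition mero_at (f : K -> K) (z0 : K) : Prop :=
  exists (n : nat) (g : K -> K),
    (\forall z \near z0, derivable g z 1)
    /\ \forall z \near z0^', (z - z0) ^+ n * f z = g z.

Implicit Types (f g : K -> K) (c : K).

Lemma derivable_mul f g (z : K) : derivable f z 1 -> derivable g z 1 ->
  derivable (fun w : K => f w * g w) z 1.
Proof. exact: derivableM. Qed.

Lemma derivable_add f g (z : K) : derivable f z 1 -> derivable g z 1 ->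
  derivable (fun w : K => f w + g w) z 1.
Proof. exact: derivableD. Qed.

Lemma derivable_subX c n (z : K) : derivable (fun w : K => (w - c) ^+ n) z 1.
Proof.
have -> : (fun w : K => (w - c) ^+ n) = (id - cst c) ^+ n.
  by apply/funext => w; rewrite fctE.
apply: derivableX; apply: derivableB; first exact: derivable_id.
exact: derivable_cst.
Qed.

Lemma mero_atM f g (z0 : K) : mero_at f z0 -> mero_at g z0 ->
  mero_at (fun z => f z * g z) z0.
Proof.
move=> [m [f' [df ff']]] [n [g' [dg gg']]].
exists (m + n)%N, (fun z => f' z * g' z); split.
  by apply: filterS2 df dg => z; exact: derivable_mul.
near=> z; rewrite exprD mulrACA; congr (_ * _); near: z.
  exact: ff'.
exact: gg'.
Unshelve. all: by end_near. Qed.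

Lemma mero_atD f g (z0 : K) : mero_at f z0 -> mero_at g z0 ->
  mero_at (fun z => f z + g z) z0.
Proof.
move=> [m [f' [df ff']]] [n [g' [dg gg']]].
exists (m + n)%N, (fun z => (z - z0) ^+ n * f' z + (z - z0) ^+ m * g' z); split.
  apply: filterS2 df dg => z df dg.
  apply: (@derivable_add (fun w => (w - z0) ^+ n * f' w)
                         (fun w => (w - z0) ^+ m * g' w)).
    exact: derivable_mul (@derivable_subX z0 n z) df.
  exact: derivable_mul (@derivable_subX z0 m z) dg.
near=> z; rewrite mulrDr exprD; congr (_ + _).
  by rewrite mulrAC mulrC; congr (_ * _); near: z; exact: ff'.
by rewrite -mulrA; congr (_ * _); near: z; exact: gg'.
Unshelve. all: by end_near. Qed.

Lemma derivable_mero_at f (z0 : K) :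
  (\forall z \near z0, derivable f z 1) -> mero_at f z0.
Proof.
by move=> df; exists 0%N, f; split => //; near=> z; rewrite mul1r.
Unshelve. all: by end_near. Qed.

Lemma mero_at_cst c (z0 : K) : mero_at (fun=> c) z0.
Proof.
by apply: derivable_mero_at; near=> z; exact: derivable_cst.
Unshelve. all: by end_near. Qed.

Lemma mero_at_id (z0 : K) : mero_at id z0.
Proof.
by apply: derivable_mero_at; near=> z; exact: derivable_id.
Unshelve. all: by end_near. Qed.

Lemma dnbhs_neq0 (z0 : K) : \forall z \near z0^', z != 0.
Proof.
have [->|z00] := eqVneq z0 0; first exact: nbhs_dnbhs_neq.
by apply: nbhs_dnbhs; exact: (@cvgr_neq0 K K K (nbhs z0) _ id z0 _ z00).
Unshelve. all: by end_near. Qed.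

Lemma mero_at_inv (z0 : K) : mero_at (fun z => z^-1) z0.
Proof.
have [->|z00] := eqVneq z0 0.
  exists 1%N, (fun=> 1); split; first by near=> z; exact: derivable_cst.
  apply: filterS (dnbhs_neq0 0) => z z0'; rewrite subr0 expr1 divff //.
apply: derivable_mero_at.
apply: filterS (@cvgr_neq0 K K K (nbhs z0) _ id z0 _ z00) => // z nz.
by apply: (@derivableV K K id).
Unshelve. all: by end_near. Qed.

Lemma mero_atX f n (z0 : K) : mero_at f z0 ->
  mero_at (fun z => f z ^+ n) z0.
Proof.
move=> mf; elim: n => [|n IHn]; first exact: mero_at_cst.
by under eq_fun do rewrite exprS; exact: mero_atM.
Qed.

Lemma mero_at_sum I (r : seq I) (P : pred I) (F : I -> K -> K) (z0 : K) :
  (forall i, P i -> mero_at (F i) z0) ->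
  mero_at (fun z => \sum_(i <- r | P i) F i z) z0.
Proof.
move=> mF; elim: r => [|i r IHr].
  by under eq_fun do rewrite big_nil; exact: mero_at_cst.
under eq_fun do rewrite big_cons.
by case Pi: (P i) => //; apply: mero_atD; [exact: mF|].
Qed.

End Meromorphic.

(** * Symbols: polynomials in [x] with coefficients meromorphic in [z] *)

Section MeromorphicPolynomials.
Variable K : numFieldType.
Implicit Types (p q : K -> {poly K}).

(** The uniform degree bound is the finite order of the operator. *)
Definition mero_poly p : Prop :=
  (exists m, forall z, (size (p z) <= m)%N) /\
  (forall j z0, mero_at (fun z => (p z)`_j) z0).

Lemma mero_poly_cst (c : {poly K}) : mero_poly (fun=> c).
Proof. by split=> [|j z0]; [exists (size c) | exact: mero_at_cst]. Qed.

Lemma mero_polyC (f : K -> K) :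
  (forall z0, mero_at f z0) -> mero_poly (fun z => (f z)%:P).
Proof.
move=> mf; split=> [|j z0]; first by exists 1%N => z; exact: size_polyC_leq1.
by under eq_fun do rewrite coefC; case: eqP => _ //; exact: mero_at_cst.
Qed.

Lemma mero_polyD p q :
  mero_poly p -> mero_poly q -> mero_poly (fun z => p z + q z).
Proof.
move=> [[m pm] mp] [[n qn] mq]; split=> [|j z0].
  exists (maxn m n) => z; rewrite (leq_trans (size_polyD _ _)) // geq_max.
  by rewrite !leq_max pm qn orbT.
by under eq_fun do rewrite coefD; exact: mero_atD.
Qed.

Lemma mero_polyM p q :
  mero_poly p -> mero_poly q -> mero_poly (fun z => p z * q z).
Proof.
move=> [[m pm] mp] [[n qn] mq]; split=> [|j z0].
  exists (m + n)%N => z; rewrite (leq_trans (size_polyMleq _ _)) //.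
  by rewrite (leq_trans (leq_pred _)) // leq_add.
under eq_fun do rewrite coefM.
by apply: mero_at_sum => i _; exact: mero_atM.
Qed.

Lemma mero_poly_sum I (r : seq I) (P : pred I) (F : I -> K -> {poly K}) :
  (forall i, P i -> mero_poly (F i)) ->
  mero_poly (fun z => \sum_(i <- r | P i) F i z).
Proof.
move=> mF; elim: r => [|i r IHr].
  by under eq_fun do rewrite big_nil; exact: mero_poly_cst.
under eq_fun do rewrite big_cons.
by case Pi: (P i) => //; apply: mero_polyD; [exact: mF|].
Qed.

Lemma mero_poly_derivn p n : mero_poly p -> mero_poly (fun z => (p z)^`(n)).
Proof.
move=> [[m pm] mp]; split=> [|j z0].
  exists m => z; apply/leq_sizeP => j mj; rewrite coef_derivn nth_default.
    by rewrite mul0rn.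
  by rewrite (leq_trans (pm z)) // (leq_trans mj) // leq_addl.
under eq_fun do rewrite coef_derivn -mulr_natr.
by apply: mero_atM => //; exact: mero_at_cst.
Qed.

(** Truncation of the Neumann series
    [(z + d/dx)^-1 = \sum_i (-1)^i z^-(i + 1) (d/dx)^i]. *)
Definition neumann (n : nat) (z : K) (c : {poly K}) : {poly K} :=
  \sum_(i < n) ((-1) ^+ i * z^-1 ^+ i.+1)%:P * c^`(i).

(** The sum telescopes down to [c] minus a multiple of [c^`(n) = 0]. *)
Lemma neumannK n (z : K) (c : {poly K}) : z != 0 -> (size c <= n)%N ->
  z%:P * neumann n z c + (neumann n z c)^`() = c.
Proof.
move=> z0 cn; rewrite /neumann mulr_sumr raddf_sum -big_split /=.
pose u i := ((-1) ^+ i * z^-1 ^+ i)%:P * c^`(i).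
rewrite (eq_bigr (fun i : 'I_n => - (u i.+1 - u i))) => [|i _].
  rewrite sumrN -(big_mkord xpredT (fun i => u i.+1 - u i)).
  rewrite telescope_sumr // /u derivn_poly0 // mulr0 sub0r opprK.
  by rewrite !expr0 mulr1 mul1r.
rewrite derivM derivC mul0r add0r -derivnS mulrA -polyCM opprB /u.
congr (_ + _).
  by rewrite mulrCA [z^-1 ^+ _]exprS [z * _]mulrA divff // mul1r.
by rewrite (exprS (-1)) mulN1r mulNr polyCN mulNr opprK.
Qed.

Lemma mero_poly_neumann n p : mero_poly p ->
  mero_poly (fun z => neumann n z (p z)).
Proof.
move=> mp; apply: mero_poly_sum => i _; apply: mero_polyM.
  apply: mero_polyC => z0; apply: mero_atM; first exact: mero_at_cst.
  by apply: mero_atX; exact: mero_at_inv.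
exact: mero_poly_derivn.
Qed.

Variable N : nat.
Implicit Types b c : K -> 'M[{poly K}]_N.

Definition mero_symbol b : Prop := forall i j, mero_poly (fun z => b z i j).

Lemma mero_symbol_bounded b : mero_symbol b ->
  exists m, forall z i j, (size (b z i j) <= m)%N.
Proof.
move=> mb.
have /choice[m bm] : forall ij : 'I_N * 'I_N, exists m, forall z,
    (size (b z ij.1 ij.2) <= m)%N.
  by move=> ij; have [] := mb ij.1 ij.2.
exists (\max_ij m ij) => z i j.
exact: leq_trans (bm (i, j) z) (leq_bigmax (i, j)).
Qed.

Lemma mero_symbol_cst (A : 'M[{poly K}]_N) : mero_symbol (fun=> A).
Proof. by move=> i j; exact: mero_poly_cst. Qed.

Lemma mero_symbolD b c :
  mero_symbol b -> mero_symbol c -> mero_symbol (fun z => b z + c z).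
Proof.
by move=> mb mc i j; under eq_fun do rewrite mxE; exact: mero_polyD.
Qed.

Lemma mero_symbolM b c :
  mero_symbol b -> mero_symbol c -> mero_symbol (fun z => b z *m c z).
Proof.
move=> mb mc i j; under eq_fun do rewrite mxE.
by apply: mero_poly_sum => l _; exact: mero_polyM.
Qed.

Lemma mero_symbol_scalar p : mero_poly p -> mero_symbol (fun z => (p z)%:M).
Proof.
move=> mp i j; under eq_fun do rewrite mxE.
by case: (i == j) => //; exact: mero_poly_cst.
Qed.

Lemma mero_symbol_neumann n b : mero_symbol b ->
  mero_symbol (fun z => map_mx (neumann n z) (b z)).
Proof.
by move=> mb i j; under eq_fun do rewrite mxE; exact: mero_poly_neumann.
Qed.
End MeromorphicPolynomials.

(** * Polynomial matrices that come from differential operators *)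

Section SpectralAlgebra.
Variables (K : numFieldType) (N : nat) (S : 'M[K]_N).
Hypothesis S_nilp : S ^+ N = 0.
Local Notation ev x := (map_mx (horner_eval x)).

(** The factor of [psi] that multiplies the exponential. *)
Definition psi_amp (x z : K) : 'M[K]_N :=
  z%:M + \sum_(1 <= m < N.+1) ((-1) ^+ m * x ^- m) *: S ^+ m.-1.

Definition pencil : 'M[{poly K}]_N := 'X%:M + map_mx polyC S.

Lemma ev_pencil x : ev x pencil = x%:M + S.
Proof.
apply/matrixP => i j; rewrite !mxE /horner_eval hornerD hornerC hornerMn.
by rewrite hornerX.
Qed.

(** The alternating sum is [- (x + S)^-1], by telescoping and [S ^+ N = 0]. *)
Lemma neumann_shift x : x != 0 ->
  let r := \sum_(1 <= m < N.+1) ((-1) ^+ m * x ^- m) *: S ^+ m.-1 in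
  (x%:M + S) * r = -1 /\ r * (x%:M + S) = -1.
Proof.
move=> x0 r.
have comm_r : (x%:M + S) * r = r * (x%:M + S).
  rewrite /r mulr_sumr mulr_suml; apply: eq_bigr => m _.
  rewrite -!mulmxE -scalemxAr -scalemxAl mulmxDl mulmxDr scalar_mxC mulmxE.
  by rewrite -exprS -exprSr.
suff rE : (x%:M + S) * r = -1 by split=> //; rewrite -comm_r.
rewrite /r big_add1 /= mulr_sumr.
pose u m := ((-1) ^+ m * x ^- m) *: S ^+ m.
rewrite (eq_bigr (fun m => u m.+1 - u m)) => [|m _].
  rewrite telescope_sumr // /u S_nilp scaler0 sub0r !expr0 invr1 mulr1.
  by rewrite scale1r.
rewrite -mulmxE -scalemxAr mulmxDl mulmxE -exprS scalerDr addrC.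
congr (_ + _); rewrite /u -mulmxE mul_scalar_mx scalerA -scaleNr; congr (_ *: _).
by rewrite exprS exprSr invfM mulN1r !mulNr -!mulrA mulVf // mulr1.
Qed.

Lemma mul_psi_amp_pencil x z : x != 0 ->
  (x%:M + S) *m psi_amp x z = z *: (x%:M + S) - 1%:M /\
  psi_amp x z *m (x%:M + S) = z *: (x%:M + S) - 1%:M.
Proof.
move=> /neumann_shift[] /=; rewrite /psi_amp -!mulmxE; set r := \sum_(_ <= _ < _) _.
move=> lr rr; split; first by rewrite mulmxDr lr scalar_mxC mul_scalar_mx.
by rewrite mulmxDl rr mul_scalar_mx.
Qed.

Lemma deriv_mxM (A B : 'M[{poly K}]_N) :
  map_mx deriv (A *m B) = map_mx deriv A *m B + A *m map_mx deriv B.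
Proof.
apply/matrixP => i j; rewrite !mxE raddf_sum -big_split /=.
by apply: eq_bigr => l _; rewrite derivM !mxE.
Qed.

Lemma deriv_pencil : map_mx deriv pencil = 1%:M.
Proof.
by apply/matrixP => i j; rewrite !mxE derivD derivC addr0 derivMn derivX.
Qed.

Lemma deriv_coef_wide (n : nat) (p : {poly K}) x : (size p <= n)%N ->
  p^`().[x] = \sum_(j < n) (x ^+ j.-1 *+ j) * p`_j.
Proof.
move=> pn; have pE : p = \sum_(j < n) p`_j *: 'X^j.
  rewrite -poly_def; apply/polyP => j; rewrite coef_poly.
  by case: ltnP => // nj; rewrite nth_default // (leq_trans pn).
rewrite [in LHS]pE raddf_sum horner_sum; apply: eq_bigr => j _ /=.
by rewrite derivZ derivXn hornerZ hornerMn hornerXn mulrC.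
Qed.

(** The left-hand side is [e^{-xz}] times the action on [psi] of the operator
    with coefficients those of the symbol [B] (compare [psi_derive1n]). *)
Lemma symbol_expansion n (P : 'M[K]_N) (B : 'M[{poly K}]_N) x :
  (forall i j, (size (B i j) <= n)%N) ->
  \sum_(j < n) (x ^+ j *: P + (x ^+ j.-1 *+ j)%:M) *m
     map_mx (fun p : {poly K} => p`_j) B =
  P *m ev x B + ev x (map_mx deriv B).
Proof.
move=> Bn; under eq_bigr do rewrite mulmxDl mul_scalar_mx -scalemxAl scalemxAr.
rewrite big_split -mulmx_sumr; congr (_ *m _ + _); apply/matrixP => i l.
  rewrite summxE !mxE /horner_eval (horner_coef_wide x (Bn i l)).
  by apply: eq_bigr => j _; rewrite !mxE mulrC.
rewrite summxE !mxE /horner_eval (deriv_coef_wide x (Bn i l)).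
by apply: eq_bigr => j _; rewrite !mxE.
Qed.

(** The equation [psi B = theta psi], for an operator [B] with symbol [b],
    divided by [e^{xz}]. *)
Definition has_symbol (theta : 'M[{poly K}]_N) : Prop :=
  exists b : K -> 'M[{poly K}]_N, mero_symbol b /\
    forall x z, x != 0 -> z != 0 ->
      psi_amp x z *m ev x (b z) + ev x (map_mx deriv (b z)) =
      ev x theta *m psi_amp x z.

Lemma has_symbol1 : has_symbol 1%:M.
Proof.
exists (fun=> 1%:M); split; first exact: mero_symbol_cst.
move=> x z _ _; rewrite !map_mx1 mulmx1 mul1mx.
rewrite [X in _ + X](_ : _ = 0) ?addr0 //.
by apply/matrixP => i j; rewrite !mxE derivMn derivC mul0rn /horner_eval horner0.
Qed.

Lemma has_symbolB t1 t2 : has_symbol t1 -> has_symbol t2 ->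
  has_symbol (t1 - t2).
Proof.
move=> [b1 [m1 e1]] [b2 [m2 e2]]; exists (fun z => b1 z - b2 z); split.
  move=> i j; under eq_fun do rewrite !mxE -mulN1r.
  apply: mero_polyD => //; apply: mero_polyM => //; exact: mero_poly_cst.
move=> x z x0 z0; rewrite !map_mxB mulmxBr mulmxBl -e1 // -e2 //.
by rewrite opprD addrACA.
Qed.

(** With [Y] the pencil, the symbol [Y h] acts as [Y (z h + h')], and
    [h = (z + d/dx)^-1 (M (z Y - 1))] turns this into
    [Y M (z Y - 1) = Y M Y P]. *)
Lemma has_symbol_sandwich (M : 'M[{poly K}]_N) : has_symbol (pencil *m M *m pencil).
Proof.
pose G z := M *m (z%:P%:M *m pencil - 1%:M).
have mG : mero_symbol G.
  apply: mero_symbolM; first exact: mero_symbol_cst.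
  apply: mero_symbolD; last exact: mero_symbol_cst.
  apply: mero_symbolM; last exact: mero_symbol_cst.
  by apply: mero_symbol_scalar; apply: mero_polyC => z0; exact: mero_at_id.
have [n Gn] := mero_symbol_bounded mG.
pose h z := map_mx (neumann n z) (G z).
exists (fun z => pencil *m h z); split.
  by apply: mero_symbolM; [exact: mero_symbol_cst | exact: mero_symbol_neumann].
move=> x z x0 z0; have [Yl Yr] := mul_psi_amp_pencil z x0.
have hG : z *: ev x (h z) + ev x (map_mx deriv (h z)) = ev x (G z).
  rewrite /h; move: (G z) (Gn z) => A An; apply/matrixP => i j.
  rewrite !mxE /horner_eval -[in RHS](neumannK z0 (An i j)).
  by rewrite hornerD hornerM hornerC.
rewrite deriv_mxM deriv_pencil mul1mx map_mxD !map_mxM ev_pencil.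
rewrite mulmxA Yr mulmxBl mul1mx addrA subrK -scalemxAl scalemxAr -mulmxDr hG.
rewrite /G map_mxM map_mxB map_mxM ev_pencil map_mx1 map_scalar_mx /=.
rewrite /horner_eval hornerC mul_scalar_mx -Yl !mulmxA.
by [].
Qed.
End SpectralAlgebra.

(** * Factorization of the idempotents *)

Section Factorization.
Variables (K : numFieldType) (N : nat).
Local Notation X := ('X : {poly K}).

Definition shift1 : 'M[K]_N := \matrix_(i, j) (i.+1 == j :> nat)%:R.

Lemma shift1_expE m i j : (shift1 ^+ m) i j = ((i + m)%N == j)%:R.
Proof.
elim: m i j => [|m IHm] i j; first by rewrite expr0 mxE addn0.
rewrite exprS -mulmxE mxE.
have [iN|Ni] := ltnP i.+1 N.
  rewrite (bigD1 (Ordinal iN)) //= big1 ?addr0 => [|l li].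
    by rewrite mxE eqxx mul1r IHm addSnnS.
  rewrite mxE; case: eqP => [e|_]; last by rewrite mul0r.
  by case/eqP: li; apply: val_inj.
rewrite big1 => [|l _]; last first.
  by rewrite mxE (gtn_eqF (leq_trans (ltn_ord l) Ni)) mul0r.
by case: eqP => // e; have := ltn_ord j; lia.
Qed.

Lemma shift1_nilp : shift1 ^+ N = 0.
Proof.
apply/matrixP => i j; rewrite shift1_expE mxE gtn_eqF //.
by rewrite (leq_trans (ltn_ord j)) // leq_addl.
Qed.

Local Notation Y := (pencil shift1).

Lemma pencil_mul_col (f : nat -> {poly K}) i :
  (Y *m \col_(j < N) f j) i 0 =
  X * f i + (if (i.+1 < N)%N then f i.+1 else 0).
Proof.
rewrite /pencil mulmxDl mul_scalar_mx !mxE; congr (_ + _).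
case: ifPn => [iN|iN].
  rewrite (bigD1 (Ordinal iN)) //= big1 ?addr0 => [|l li].
    by rewrite !mxE eqxx mul1r.
  rewrite !mxE; case: eqP => [e|_]; last by rewrite mul0r.
  by case/eqP: li; apply: val_inj.
rewrite big1 // => l _; rewrite !mxE gtn_eqF ?mul0r //.
by rewrite (leq_trans (ltn_ord l)) // leqNgt.
Qed.

Lemma row_mul_pencil (f : nat -> {poly K}) j :
  ((\row_(i < N) f i) *m Y) 0 j =
  f j * X + (if (0 < j)%N then f j.-1 else 0).
Proof.
rewrite /pencil mulmxDr scalar_mxC mul_scalar_mx !mxE mulrC; congr (_ + _).
case: j => -[|j] jN /=.
  by rewrite big1 // => l _; rewrite !mxE mulr0.
rewrite (bigD1 (Ordinal (ltnW jN))) //= big1 ?addr0 => [|l li].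
  by rewrite !mxE eqxx mulr1.
rewrite !mxE; case: eqP => [[e]|_]; last by rewrite mulr0.
by case/eqP: li; apply: val_inj.
Qed.

(** Row and column indices start at [0], the index [k] at [1]. *)
Definition alpha_col k : 'cV[{poly K}]_N :=
  \col_i ((i.+1 == k)%:R - (i.+1 == N)%:R * (- X) ^+ (N - k)).

Definition alpha_row k : 'rV[{poly K}]_N :=
  \row_j ((j.+1 == k)%:R - (j.+1 == 1)%N%:R * (- X) ^+ k.-1).

(** The quotient solves [X q_i + q_(i + 1) = u_i], with [u] the column, upwards from
    [q_k = 1]: a geometric progression, whose last equation, in row [N], is what
    forces the second entry of [alpha_col k]. *)
Lemma alpha_col_div k : (k < N)%N ->
  alpha_col k = Y *m \col_(i < N) (if (k <= i)%N then (- X) ^+ (i - k) else 0).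
Proof.
move=> kN; apply/colP => i.
rewrite (pencil_mul_col (fun i => if (k <= i)%N then (- X) ^+ (i - k) else 0)) mxE.
have iN := ltn_ord i; have [iN1|iN1] := ltnP i.+1 N.
  rewrite (ltn_eqF iN1) mul0r subr0.
  have [ik|ki|<-] := ltngtP i.+1 k.
  - by rewrite leqNgt (ltnW ik) /= mulr0 addr0.
  - by rewrite -[(k <= i)%N]ltnS ki subSn // exprS mulNr subrr.
  - by rewrite ltnn mulr0 add0r subnn expr0.
have -> : i.+1 == N by rewrite eqn_leq iN iN1.
rewrite gtn_eqF ?(leq_trans kN) // ifT; last by lia.
have -> : (N - k = (i - k).+1)%N by lia.
by rewrite addr0 mul1r sub0r exprS mulNr opprK.
Qed.

(** Dually, [X t_j + t_(j - 1) = v_j], with [v] the row, is solved downwards from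
    [t_(k - 1) = 1], and the equation in column [1] gives the second entry of
    [alpha_row k]. *)
Lemma alpha_row_div k : (1 < k)%N ->
  alpha_row k =
  (\row_(j < N) (if (j.+1 < k)%N then (- X) ^+ (k - j.+2) else 0)) *m Y.
Proof.
move=> k1; apply/rowP => j.
rewrite (row_mul_pencil (fun j => if (j.+1 < k)%N then (- X) ^+ (k - j.+2) else 0)) mxE.
case: j => -[|j] jN /=.
  rewrite (ltn_eqF k1) k1 mul1r sub0r addr0.
  have -> : (k.-1 = (k - 2).+1)%N by lia.
  by rewrite exprSr mulrN opprK.
rewrite mul0r subr0; have [jk|kj|<-] := ltngtP j.+2 k.
- have -> : (k - j.+2 = (k - j.+3).+1)%N by lia.
  by rewrite exprSr mulrN subrr.
- by rewrite mul0r add0r.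
- by rewrite mul0r add0r subnn.
Qed.

(** The row [k] meets the column [l] only at index [k = l]: the other entry of
    the row is at index [1 < l], the other one of the column at [N > k]. *)
Lemma alpha_row_col k l : (1 < k < N)%N -> (1 < l < N)%N ->
  alpha_row k *m alpha_col l = (k == l)%:R%:M.
Proof.
move=> /andP[k1 kN] /andP[l1 lN]; apply/rowP => z; rewrite ord1 !mxE.
have k1N : (k.-1 < N)%N by lia.
rewrite (bigD1 (Ordinal k1N)) //= big1 => [|i].
  rewrite !mxE /= prednK ?(ltnW k1) // eqxx (gtn_eqF k1) (ltn_eqF kN).
  by rewrite !mul0r !subr0 mul1r addr0 mulr1n.
rewrite -val_eqE /= => ik; rewrite !mxE.
have -> : (i.+1 == k) = false by lia.
have [->|_] := eqVneq i.+1 1%N; last by rewrite mul0r subrr mul0r.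
have -> : (1%N == l) = false by lia.
have -> : (1%N == N) = false by lia.
by rewrite mul0r subrr mulr0.
Qed.

End Factorization.

(** * Completing orthogonal idempotents *)

Section Pierce.
Variables (T : pzRingType) (N : nat) (e : nat -> T).
Hypothesis N2 : (1 < N)%N.
Hypothesis e_orth : forall k l, (1 < k < N)%N -> (1 < l < N)%N ->
  e k * e l = (k == l)%:R * e k.

Lemma pierce_complement (A : set T) :
  let a k := if k == 1%N then 1 - \sum_(2 <= l < N) e l else e k in
  (forall k, (0 < k < N)%N -> A (a k)) ->
  pierce_decomposition A (fun i : 'I_(N - 1) => a i.+1).
Proof.
move=> a Aa; set s := \sum_(2 <= l < N) e l in a Aa *.
have aE k : (1 < k)%N -> a k = e k by move=> k1; rewrite /a gtn_eqF.
have es k : (1 < k < N)%N -> e k * s = e k.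
  move=> kN; rewrite mulr_sumr (bigD1_seq k) ?mem_index_iota ?iota_uniq //=.
  rewrite e_orth // eqxx mul1r big1_seq ?addr0 // => l /andP[lk].
  by rewrite mem_index_iota => lN; rewrite e_orth // eq_sym (negPf lk) mul0r.
have se k : (1 < k < N)%N -> s * e k = e k.
  move=> kN; rewrite mulr_suml (bigD1_seq k) ?mem_index_iota ?iota_uniq //=.
  rewrite e_orth // eqxx mul1r big1_seq ?addr0 // => l /andP[lk].
  by rewrite mem_index_iota => lN; rewrite e_orth // (negPf lk) mul0r.
have ss : s * s = s.
  by rewrite {1}/s mulr_suml; apply: eq_big_nat => k; exact: es.
have iN (i : 'I_(N - 1)) : (i.+1 < N)%N by have := ltn_ord i; lia.
split=> [i||i j].
- by apply: Aa; rewrite iN.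
- transitivity (\sum_(1 <= k < N) a k); last first.
    by rewrite big_add1 big_mkord subn1.
  rewrite big_ltn //.
  rewrite (eq_big_nat _ _ (F2 := e)) => [|k /andP[k1 _]]; last exact: aE.
  by rewrite /a /= subrK.
- suff aa k l : (0 < k < N)%N -> (0 < l < N)%N -> a k * a l = (k == l)%:R * a k.
    by rewrite aa ?iN // eqSS.
  rewrite /a; have [->|k1] := eqVneq k 1%N; have [->|l1] := eqVneq l 1%N => kN lN.
  + by rewrite mul1r mulrBl mul1r mulrBr mulr1 ss subrr subr0.
  + by rewrite mul0r mulrBl mul1r se ?subrr //; lia.
  + by rewrite (negPf k1) mul0r mulrBr mulr1 es ?subrr //; lia.
  + by rewrite e_orth //; lia.
Qed.
End Pierce.

(** * The algebra of the bispectral function *)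

Section BispectralAlgebra.
Variables (R : realType) (N : nat).
Local Notation C := (Cplx R).

Lemma shift_mxE : shift_mx R N = shift1 C N.
Proof.
apply/matrixP => i j; rewrite /shift_mx summxE mxE.
under eq_bigr do rewrite mxE.
have [ij|ij] := eqVneq i.+1 j; last first.
  rewrite big1 // => s _; case: (altP (i.+1 =P s)) => [<-|//] /=.
  by rewrite eqSS eq_sym (negPf ij).
have jN := ltn_ord j.
rewrite (bigD1_seq i.+1) ?mem_index_iota ?iota_uniq //=; last by lia.
rewrite !eqxx eqSS -ij eqxx /= big1 ?addr0 // => s si.
by rewrite eq_sym (negPf si).
Qed.

Lemma psiE x z : psi N x z = cexp (x * z) *: psi_amp (shift1 C N) x z.
Proof. by rewrite /psi shift_mxE. Qed.

Lemma alpha_ge2E k : (1 < k < N)%N ->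
  alpha_ge2 R N k = alpha_col C N k *m alpha_row C N k.
Proof.
move=> /andP[k1 kN]; apply/matrixP => i l.
have pick m (F : nat -> {poly C}) : (0 < m < N)%N ->
    \sum_(1 <= j < N) (j == m)%:R * F j = F m.
  move=> mN; rewrite (bigD1_seq m) ?mem_index_iota ?iota_uniq //= eqxx mul1r.
  by rewrite big1 ?addr0 // => j /negPf ->; rewrite mul0r.
pose X : {poly C} := 'X.
pose a : {poly C} := ((i.+1 == k) && (l.+1 == 1%N))%:R.
pose b : {poly C} := ((i.+1 == N) && (l.+1 == k))%:R.
pose c : {poly C} := ((i.+1 == N) && (l.+1 == 1%N))%:R.
have termE j : (1 <= j < N)%N ->
    ('X^j *: map_mx polyC (acoef R N k j)) i l =
    (j == k.-1)%:R * (- (- X) ^+ j * a) + (j == N - k)%N%:R * (- (- X) ^+ j * b)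
    + (j == N.-1)%:R * ((- X) ^+ j * c).
  move=> jN; rewrite !mxE.
  (* each of the three Kronecker deltas selects a single power of [X] *)
  have -> : (k == j.+1) = (j == k.-1) by lia.
  have -> : (k == N - j)%N = (j == N - k)%N by lia.
  have -> : (N == j.+1) = (j == N.-1) by lia.
  rewrite !(rmorphD, rmorphM, rmorphXn, rmorphN, rmorph1, rmorph_nat) /=.
  rewrite -/a -/b -/c -/X [(- X) ^+ j]exprNn exprS.
  by ring.
rewrite mxE summxE (eq_big_nat _ _ termE) !big_split /= !pick; try lia.
rewrite !mxE big_ord1 !mxE /a /b /c -/X -!mulnb !natrM rmorphM !rmorph_nat.
rewrite (_ : N.-1 = N - k + k.-1)%N ?exprD; last by lia.
by ring.
Qed.

Lemma alpha_ge2_sandwich k : (1 < k < N)%N ->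
  exists M, alpha_ge2 R N k = pencil (shift1 C N) *m M *m pencil (shift1 C N).
Proof.
move=> kN; have /andP[k1 k2] := kN.
rewrite alpha_ge2E // alpha_col_div // alpha_row_div //.
set q := \col__ _; set t := \row__ _.
by exists (q *m t); rewrite !mulmxA.
Qed.

Lemma psi_derive1n j x z :
  mx_derive1n j (psi N x) z =
  cexp (x * z) *: (x ^+ j *: psi_amp (shift1 C N) x z + (x ^+ j.-1 *+ j)%:M).
Proof.
apply/matrixP => i l; rewrite mxE.
pose p := (\sum_(1 <= m < N.+1) ((-1) ^+ m * x ^- m) *: shift1 C N ^+ m.-1) i l.
have ampE w : psi_amp (shift1 C N) x w i l = w * (i == l)%:R + p.
  by rewrite !mxE mulr_natr.
have -> : (fun w => psi N x w i l) =
    (fun w => cexp (x * w) * (w * (i == l)%:R + p)).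
  by apply/funext => w; rewrite psiE mxE ampE.
rewrite (derive1n_exp_affine (@is_derive_cexp R)) [RHS]mxE; congr (_ * _).
by rewrite [RHS]mxE; congr (_ + _); rewrite mxE ?ampE ?mulr_natr.
Qed.

(** The whole plane serves as domain: the coefficients are meromorphic on it, and
    the symbol equation, valid for [z != 0], holds on small punctured
    neighbourhoods of every point. *)
Lemma has_symbol_algA (theta : 'M[{poly C}]_N) :
  has_symbol (shift1 C N) theta -> algA theta.
Proof.
move=> [b [mb be]]; have [m bm] := mero_symbol_bounded mb.
exists [set: C], m, (fun j z => map_mx (fun p : {poly C} => p`_j) (b z)); split.
- split; [by exists 0 | exact: openT | exact: connected_Cplx].
- move=> j i l z0 _; under eq_fun do rewrite mxE.
  exact: (mb i l).2.
- move=> x x0 z0 _; apply: filterS (dnbhs_neq0 z0) => z zn0.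
  rewrite /right_action; under eq_bigr do rewrite psi_derive1n -scalemxAl.
  rewrite -scaler_sumr psiE -scalemxAr symbol_expansion ?be // => i j.
  exact: leqW.
Qed.

End BispectralAlgebra.

Theorem corollary6 (R : realType) (N : nat) (hN : (3 <= N)%N) :
  pierce_decomposition (@algA R N) (fun i : 'I_(N - 1) => @alpha R N i.+1).
Proof.
have e_orth k l : (1 < k < N)%N -> (1 < l < N)%N ->
    alpha_ge2 R N k * alpha_ge2 R N l = (k == l)%:R * alpha_ge2 R N k.
  move=> kN lN; rewrite !alpha_ge2E // -!mulmxE.
  rewrite -mulmxA [X in _ *m X]mulmxA alpha_row_col // mul_scalar_mx -scalemxAr.
  case: eqP => [->|_]; first by rewrite scale1r mul1mx.
  by rewrite scale0r mul0mx.
have e_symbol k : (1 < k < N)%N -> has_symbol (shift1 _ N) (alpha_ge2 R N k).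
  move=> kN; have [M ->] := alpha_ge2_sandwich R kN.
  exact: has_symbol_sandwich (shift1_nilp _ _) M.
apply: (pierce_complement (ltnW hN) e_orth) => k kN.
apply: has_symbol_algA; have [k1|k1] := eqVneq k 1%N; last by apply: e_symbol; lia.
have := has_symbol1 (shift1 _ N).
rewrite big_nat; elim/big_rec: _ => [|l A lN IH] sB; first by rewrite subr0.
by rewrite opprD addrA addrAC; apply: has_symbolB; [exact: IH|exact: e_symbol].
Qed.
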